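(* Let $(R,\mathfrak{m})$ be a Cohen-Macaulay local ring and let $J$ be an ideal of $R$ of grade $g\geq 1$. Then: (a) if $g$ is odd, $P_{\omega_{R/J}}^{\leq g}(-1)\leq 0$; in particular, if $g=1$, then $\beta_1^R(\omega_{R/J})\geq \beta_0^R(\omega_{R/J})$; (b) if $g$ is even, $P_{\omega_{R/J}}^{\leq g}(-1)\geq 0$.
   Context: With $k=R/\mathfrak{m}$, for a finitely generated $R$-module $M$, $\beta_i^R(M)=\dim_k\operatorname{Tor}_i^R(k,M)$ is the $i$th Betti number, and for an integer $s$, $P_M^{\leq s}(t)=\sum_{i=0}^{s}\beta_i^R(M)t^i$ is the partial sum of the Poincaré series of $M$. $\omega_{R/J}$ denotes the canonical module of $R/J$, taken here as $\omega_{R/J}=\operatorname{Ext}^g_R(R/J,R)$, where $g=\operatorname{grade}(J)$. *)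

(* Defs.v *)
From HB Require Import structures.
From mathcomp Require Import all_boot all_order all_algebra ring_quotient.
From mathcomp Require Import boolp classical_sets.

Set Implicit Arguments.
Unset Strict Implicit.
Unset Printing Implicit Defensive.
Import Order.TTheory GRing.Theory Num.Theory.
Local Open Scope ring_scope.
Local Open Scope quotient_scope.

Section QuotientModule.
Variables (R : nzRingType) (V : lmodType R) (S : submodClosed V).

(* [submodClosed] does not inherit from [zmodClosed]. *)
Definition submod_pred : {pred V} := S.
Fact submod_pred_closed : zmod_closed submod_pred.
Proof.
split=> [|u v uS vS]; first exact: (rpred0 S).
by rewrite /submod_pred -scaleN1r rpredD // rpredZ.
Qed.
HB.instance Definition _ :=
  GRing.isZmodClosed.Build V submod_pred submod_pred_closed.

Definition quotmod : Type := {ideal_quot submod_pred}.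
HB.instance Definition _ := GRing.Zmodule.on quotmod.

Definition quotmod_pi (v : V) : quotmod := \pi_{ideal_quot submod_pred} v.

Definition quotmod_scale (a : R) (x : quotmod) : quotmod :=
  quotmod_pi (a *: (repr (x : {ideal_quot submod_pred}) : V)).

Lemma quotmod_piP (u v : V) : quotmod_pi u = quotmod_pi v <-> u - v \in S.
Proof.
by split=> [/eqP|uv]; [|apply/eqP]; rewrite /quotmod_pi -Quotient.idealrBE.
Qed.

Lemma quotmod_piD (u v : V) :
  quotmod_pi (u + v) = quotmod_pi u + quotmod_pi v.
Proof. by rewrite /quotmod_pi raddfD. Qed.

Lemma quotmod_reprK (x : quotmod) :
  quotmod_pi (repr (x : {ideal_quot submod_pred}) : V) = x.
Proof. by rewrite /quotmod_pi reprK. Qed.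

Lemma quotmod_piZ a (v : V) :
  quotmod_pi (a *: v) = quotmod_scale a (quotmod_pi v).
Proof.
apply/quotmod_piP; rewrite -scalerBr rpredZ //.
by apply/quotmod_piP; rewrite quotmod_reprK.
Qed.

Fact quotmod_scalerA a b x :
  quotmod_scale a (quotmod_scale b x) = quotmod_scale (a * b) x.
Proof. by rewrite -[x]quotmod_reprK -!quotmod_piZ scalerA. Qed.

Fact quotmod_scale1r : left_id 1 quotmod_scale.
Proof. by move=> x; rewrite -[x]quotmod_reprK -quotmod_piZ scale1r. Qed.

Fact quotmod_scalerDr : right_distributive quotmod_scale +%R.
Proof.
move=> a x y; rewrite -[x]quotmod_reprK -[y]quotmod_reprK.
by rewrite -quotmod_piD -!quotmod_piZ scalerDr quotmod_piD.
Qed.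

Fact quotmod_scalerDl x :
  {morph (fun a => quotmod_scale a x) : a b / a + b}.
Proof.
move=> a b; rewrite -[x]quotmod_reprK -!quotmod_piZ.
by rewrite scalerDl quotmod_piD.
Qed.

HB.instance Definition _ := GRing.Zmodule_isLmodule.Build R quotmod
  quotmod_scalerA quotmod_scale1r quotmod_scalerDr quotmod_scalerDl.

End QuotientModule.

Section Homology.
Variables (R : nzRingType) (U V W : lmodType R).
Variables (f : {linear U -> V}) (g : {linear V -> W}).

Definition ker_pred : {pred V} := [pred v | g v == 0].

Fact ker_submod_closed : submod_closed ker_pred.
Proof.
split=> [|a u v]; rewrite !inE ?raddf0 // => /eqP gu /eqP gv.
by rewrite linearP gu gv scaler0 addr0.
Qed.
HB.instance Definition _ :=
  GRing.isSubmodClosed.Build R V ker_pred ker_submod_closed.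

Definition kernel : Type := {v : V | ker_pred v}.
HB.instance Definition _ := SubChoice.on kernel.
HB.instance Definition _ := [SubChoice_isSubLmodule of kernel by <:].

Definition boundary : {pred kernel} :=
  [pred z | `[< exists u : U, f u = val z >]].

Fact boundary_submod_closed : submod_closed boundary.
Proof.
split=> [|a x y]; rewrite !inE.
  by exists 0; rewrite !raddf0.
move=> [u fu] [v fv].
by exists (a *: u + v); rewrite !linearP fu fv.
Qed.
HB.instance Definition _ :=
  GRing.isSubmodClosed.Build R kernel boundary boundary_submod_closed.

(* ker g / (im f \cap ker g), that is, the homology at V of U -> V -> W when  *)
(* g \o f = 0.                                                                *)
Definition homology : lmodType R := quotmod boundary.

End Homology.

(* [idealr R] consists of the proper ideals of R (the unit ideal is excluded). *)

Section Rings.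
Variable R : comNzRingType.

Definition in_span (s : seq R) (x : R) : Prop :=
  exists c : 'I_(size s) -> R, x = \sum_(i < size s) c i * s`_i.

Definition noetherian : Prop :=
  forall I : idealr R, exists s : seq R, forall x, x \in I <-> in_span s x.

Definition maximal_ideal (m : idealr R) : Prop :=
  forall I : idealr R, {subset m <= I} -> {subset I <= m}.

Definition local_ring (m : idealr R) : Prop :=
  maximal_ideal m /\ forall n : idealr R, maximal_ideal n -> n =i m.

Definition regular_seq (s : seq R) : Prop :=
  ~ in_span s 1 /\
  forall i, (i < size s)%N ->
  forall r, in_span (take i s) (s`_i * r) -> in_span (take i s) r.

(* The grade of J is the maximal length of an R-regular sequence in J; the    *)
(* depth of (R, m) is the grade of m.                                         *)
Definition is_grade (J : idealr R) (g : nat) : Prop :=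
  (exists s, [/\ {subset s <= J}, regular_seq s & size s = g]) /\
  forall s, {subset s <= J} -> regular_seq s -> (size s <= g)%N.

Definition prime_chain (P : nat -> prime_idealr R) (n : nat) : Prop :=
  forall i, (i < n)%N ->
    {subset P i <= P i.+1} /\ exists2 x, x \in P i.+1 & x \notin P i.

Definition is_krull_dim (d : nat) : Prop :=
  (exists P, prime_chain P d) /\ forall P n, prime_chain P n -> (n <= d)%N.

Definition CM_local_ring (m : idealr R) : Prop :=
  [/\ noetherian, local_ring m & exists d, is_grade m d /\ is_krull_dim d].

Lemma CM_local_maximal m : CM_local_ring m -> maximal_ideal m.
Proof. by case=> _ []. Qed.

Definition ideal_sub (J : idealr R) : {pred R^o} := [pred x : R^o | x \in J].

Fact ideal_sub_submod_closed J : submod_closed (ideal_sub J).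
Proof.
split=> [|a u v]; rewrite !inE; first exact: rpred0.
by move=> uJ vJ; rewrite rpredD // idealMr.
Qed.
HB.instance Definition _ J :=
  GRing.isSubmodClosed.Build R R^o (ideal_sub J) (ideal_sub_submod_closed J).

Definition quot_by_ideal (J : idealr R) : lmodType R := quotmod (ideal_sub J).

End Rings.

Section ResidueField.
Variables (R : comNzRingType) (m : idealr R) (mmax : maximal_ideal m).

Definition residue_field of maximal_ideal m : Type := {ideal_quot m}.
Local Notation k := (residue_field mmax).
HB.instance Definition _ := GRing.ComNzRing.on k.

Definition residue (x : R) : k := \pi_{ideal_quot m} x.

Lemma residue_eq0 x : (residue x == 0) = (x \in m).
Proof. by rewrite -[x in RHS]subr0 Quotient.idealrBE /residue raddf0. Qed.

Fact residue_is_zmod_morphism : zmod_morphism residue.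
Proof. by move=> x y; rewrite /residue raddfB. Qed.
Fact residue_is_monoid_morphism : monoid_morphism residue.
Proof. by split=> [|x y]; rewrite /residue ?rmorph1 ?rmorphM. Qed.
HB.instance Definition _ :=
  GRing.isZmodMorphism.Build R k residue residue_is_zmod_morphism.
HB.instance Definition _ :=
  GRing.isMonoidMorphism.Build R k residue residue_is_monoid_morphism.

Lemma residue_surj (y : k) : exists x, residue x = y.
Proof. by exists (repr (y : {ideal_quot m})); rewrite /residue reprK. Qed.

Lemma residue_has_inv (y : k) : y != 0 -> exists z : k, z * y = 1.
Proof.
have [x <-] := residue_surj y; rewrite residue_eq0 => xm.
apply: contrapT => noinv.
pose S : {pred R} := [pred u | `[< exists a b, b \in m /\ u = a * x + b >]].
have S_closed : idealr_closed S.
  split=> [||a u v].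
  - rewrite inE; exists 0, 0.
    by rewrite rpred0 mul0r addr0.
  - apply/negP; rewrite inE => -[a [b [bm e]]].
    apply: noinv; exists (residue a); rewrite -rmorphM -(rmorph1 residue).
    by apply/eqP; rewrite eq_sym -subr_eq0 -rmorphB residue_eq0 e addrC addKr.
  - rewrite !inE => -[c [d [dm ->]]] [c' [d' [d'm ->]]].
    exists (a * c + c'), (a * d + d').
    rewrite rpredD ?idealMr //; split=> //.
    by rewrite mulrDr mulrDl mulrA !addrA; congr (_ + _); rewrite addrAC.
pose I : idealr R := HB.pack S (isIdealr.Build R S S_closed).
have mI : {subset m <= I}.
  move=> b bm; rewrite /I inE; exists 0, b.
  by rewrite mul0r add0r.
case/negP: xm; apply: (mmax mI).
rewrite /I inE; exists 1, 0.
by rewrite rpred0 mul1r addr0.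
Qed.

Definition residue_inv (y : k) : k :=
  if y == 0 then 0 else xget 0 [set z : k | z * y = 1]%classic.

Fact residue_mulVf (y : k) : y != 0 -> residue_inv y * y = 1.
Proof.
move=> y0; rewrite /residue_inv (negPf y0).
have [z zy] := residue_has_inv y0.
exact: (@xgetPex k 0 [set z : k | z * y = 1]%classic (ex_intro _ z zy)).
Qed.

Fact residue_inv0 : residue_inv 0 = 0.
Proof. by rewrite /residue_inv eqxx. Qed.

HB.instance Definition _ :=
  GRing.ComNzRing_isField.Build k residue_mulVf residue_inv0.

End ResidueField.

(* Resolutions by free modules of finite rank: elements of F_i = R^(rk i) are *)
(* row vectors, and F_i.+1 -> F_i is u |-> u *m bd i. Over a Noetherian ring, *)
(* every finitely generated module has one, and Ext and Tor computed from it  *)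
(* do not depend on it up to isomorphism.                                     *)
Record free_resolution (R : comNzRingType) (M : lmodType R) := FreeResolution {
  rk : nat -> nat;
  bd : forall i, 'M[R]_(rk i.+1, rk i);
  aug : {linear 'rV[R]_(rk 0) -> M};
  aug_surj : forall x, exists u, aug u = x;
  aug_exact : forall u, aug u = 0 <-> exists v, u = v *m bd 0;
  bd_exact : forall i (u : 'rV[R]_(rk i.+1)),
    u *m bd i = 0 <-> exists v, u = v *m bd i.+1
}.

Section ExtTor.
Variables (R : comNzRingType) (M : lmodType R) (F : free_resolution M).

(* Ext^i_R(M, R) = H^i(Hom_R(F, R)): the column vector c stands for the       *)
(* linear form u |-> u *m c on F_i, so that precomposition with bd i is       *)
(* c |-> bd i *m c.                                                           *)
Definition Ext (i : nat) : lmodType R :=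
  match i with
  | 0 => homology (mulmx (0 : 'M[R]_(rk F 0, 0)) : {linear 'cV_0 -> 'cV_(rk F 0)})
                  (mulmx (bd F 0) : {linear 'cV_(rk F 0) -> 'cV_(rk F 1)})
  | j.+1 => homology
      (mulmx (bd F j) : {linear 'cV_(rk F j) -> 'cV_(rk F j.+1)})
      (mulmx (bd F j.+1) : {linear 'cV_(rk F j.+1) -> 'cV_(rk F j.+2)})
  end.

Variables (m : idealr R) (mmax : maximal_ideal m).
Local Notation k := (residue_field mmax).

Definition bdk (i : nat) : 'M[k]_(rk F i.+1, rk F i) :=
  map_mx (residue mmax) (bd F i).

(* Tor_i^R(k, M) = H_i(k \otimes_R F), where k \otimes_R R^n = k^n. *)
Definition Tor (i : nat) : lmodType k :=
  match i with
  | 0 => homology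
      (mulmxr (bdk 0) : {linear 'rV_(rk F 1) -> 'rV_(rk F 0)})
      (mulmxr (0 : 'M[k]_(rk F 0, 0)) : {linear 'rV_(rk F 0) -> 'rV_0})
  | j.+1 => homology
      (mulmxr (bdk j.+1) : {linear 'rV_(rk F j.+2) -> 'rV_(rk F j.+1)})
      (mulmxr (bdk j) : {linear 'rV_(rk F j.+1) -> 'rV_(rk F j)})
  end.

End ExtTor.

(* By convention 0 if V is not finite dimensional. *)
Definition dimension (k : fieldType) (V : lmodType k) : nat :=
  xget 0%N [set n | inhabited (Vector.axiom n V)]%classic.

Section Betti.
Variables (R : comNzRingType) (m : idealr R) (mmax : maximal_ideal m).
Variables (M : lmodType R) (F : free_resolution M).

Definition betti (i : nat) : nat := dimension (Tor F mmax i).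

Definition poincare_le (s : nat) : {poly int} :=
  \poly_(i < s.+1) (betti i)%:Z.

End Betti.

(* Main.v *)
(* Some nonzerodivisor x of J kills M = Ext^g(R/J, R), so x is null-homotopic
   on any free resolution G of M; hence G becomes exact over every field K with
   a morphism phi : R -> K such that phi x != 0.  Counting ranks, the
   alternating sum of the Betti numbers up to n is (-1)^n times
   rank_K (bd_n) - rank_k (bd_n), where k = R/m.  If P and Q are matrices over
   R such that P bd_n Q is the identity of size rank_k (bd_n) modulo m, then
   d = det (P bd_n Q) lies outside m, so x d is not nilpotent and phi (x d) != 0
   for some K; for this K, rank_k (bd_n) <= rank_K (bd_n). *)
From HB Require Import structures.
Require Import Defs.
From mathcomp Require Import all_boot all_order all_algebra ring_quotient.
From mathcomp Require Import boolp classical_sets.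

Set Implicit Arguments.
Unset Strict Implicit.
Unset Printing Implicit Defensive.
Import Order.TTheory GRing.Theory Num.Theory.
Local Open Scope ring_scope.

(** * Existence of maximal ideals, by Zorn's lemma *)

Section MaximalIdeals.
Variable R : comNzRingType.

(** The union of the chain is an ideal, because any two of its elements lie in a common member. It
    is proper, because no member contains 1. *)
Lemma chain_idealr_ub (A : set (idealr R)) (I0 : idealr R) : A I0 ->
  (forall I J, A I -> A J -> {subset I <= J} \/ {subset J <= I}) ->
  exists U : idealr R, forall I, A I -> {subset I <= U}.
Proof.
move=> AI0 totA.
pose S : {pred R} := [pred u | `[< exists2 I : idealr R, A I & u \in I >]].
have S_closed : idealr_closed S.
  split=> [||a u v].
  - by rewrite inE; exists I0; rewrite ?rpred0.
  - by apply/negP; rewrite inE => -[I _]; rewrite idealr1.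
  rewrite !inE => -[I AI uI] [J AJ vJ].
  have [IJ|JI] := totA _ _ AI AJ.
    by exists J; rewrite // rpredD // idealMr // IJ.
  by exists I => //; apply: rpredD; [exact: idealMr|exact: JI].
exists (HB.pack S (isIdealr.Build R S S_closed) : idealr R) => I AI u uI.
by rewrite inE; exists I.
Qed.

Lemma exists_maximal_ideal (I : idealr R) :
  exists2 M : idealr R, maximal_ideal M & {subset I <= M}.
Proof.
pose T := {J : idealr R | `[< {subset I <= J} >]}.
have IT (t : T) : {subset I <= sval t} by apply/asboolP; exact: (svalP t).
pose t0 : T := exist _ I (asboolT (fun x (h : x \in I) => h)).
pose le (s t : T) := `[< {subset sval s <= sval t} >].
have [|||M Mmax] := @ZL_preorder T t0 le.
- by move=> t; apply/asboolP.
- by move=> r s t /asboolP rs /asboolP st; apply/asboolP => x /rs /st.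
- move=> A totA.
  (* The empty chain is bounded by [I] itself; its union would not even contain 0. *)
  have [[s0 As0]|A0] := pselect (exists s, A s); last first.
    by exists t0 => s As; case: A0; exists s.
  have [||U Uub] := @chain_idealr_ub
      [set J | exists2 s, A s & J = sval s]%classic (sval s0).
    by exists s0.
    move=> _ _ [s As ->] [t At ->].
    by have [/asboolP|/asboolP] := totA _ _ As At; [left|right].
  have IU : `[< {subset I <= U} >].
    by apply/asboolP => x /(IT s0) xs; apply: (Uub (sval s0)) => //; exists s0.
  by exists (exist _ U IU) => s As; apply/asboolP; apply: Uub; exists s.
exists (sval M); last exact: IT.
move=> J MJ.
have IJ : `[< {subset I <= J} >] by apply/asboolP => x /(IT M) /MJ.
have /asboolP := Mmax (exist _ J IJ) (asboolT MJ); exact.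
Qed.

End MaximalIdeals.

(** * Fields in which a non-nilpotent element stays nonzero *)

Section ResidueFields.
Variable R : comNzRingType.

(* In R[1/y] = R['X]/(y * 'X - 1), the equality [1 = 0] means that [y] is nilpotent. *)
Lemma nonnilpotent_mulX_sub1 (y : R) : (forall n, y ^+ n != 0) ->
  forall q : {poly R}, q * (y%:P * 'X - 1) != 1.
Proof.
move=> ynil q; apply/negP => /eqP e.
have coefE i : (q * (y%:P * 'X - 1))`_i = (i == 0)%N%:R by rewrite e coef1.
(* Comparing coefficients forces [q] to agree with the series of -1/(1 - yX); its coefficient at
   index [size q] vanishes, which makes [y] nilpotent. *)
have qE i : q`_i = - y ^+ i.
  have := coefE i; rewrite mulrBr mulr1 mulrA coefB coefMX.
  elim: i => [|i IH] /=; first by rewrite sub0r => /(canRL opprK) ->; rewrite expr0.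
  rewrite coefMC => /eqP; rewrite subr_eq0 => /eqP <-.
  have := coefE i; rewrite mulrBr mulr1 mulrA coefB coefMX.
  by move/IH ->; rewrite mulNr -exprSr.
by case/negP: (ynil (size q)); rewrite -oppr_eq0 -qE nth_default.
Qed.

(** The field is R[X]/M, with M a maximal ideal containing the proper ideal generated by yX - 1: the
    class of X is an inverse of the image of [y]. *)
Lemma exists_field_nonnilpotent (y : R) : (forall n, y ^+ n != 0) ->
  exists (K : fieldType) (phi : {rmorphism R -> K}), phi y != 0.
Proof.
move=> /nonnilpotent_mulX_sub1 q1; pose p := y%:P * 'X - 1.
pose S : {pred {poly R}} := [pred u | `[< exists q, u = q * p >]].
have S_closed : idealr_closed S.
  split=> [||a u v].
  - by rewrite inE; exists 0; rewrite mul0r.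
  - by apply/negP; rewrite inE => -[q /esym/eqP]; apply/negP; exact: q1.
  rewrite !inE => -[q ->] [r ->].
  by exists (a * q + r); rewrite mulrDl mulrA.
pose I : idealr {poly R} := HB.pack S (isIdealr.Build _ S S_closed).
have [M Mmax SM] := exists_maximal_ideal I.
exists (residue_field Mmax), (residue Mmax \o polyC)%FUN; apply/negP => /eqP /= y0.
have yX : residue Mmax (y%:P * 'X) = residue Mmax y%:P * residue Mmax 'X.
  exact: rmorphM.
have : residue Mmax (y%:P * 'X) - residue Mmax 1 == 0.
  rewrite -raddfB residue_eq0; apply: SM; rewrite inE.
  by exists 1; rewrite mul1r.
have -> : residue Mmax 1 = 1 by exact: rmorph1.
by rewrite yX y0 mul0r sub0r oppr_eq0 oner_eq0.
Qed.

End ResidueFields.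

(** * Annihilation of quotient modules *)

Section QuotientModule.
Variables (R : nzRingType) (V : lmodType R) (S : submodClosed V).

Lemma quotmod_scaleE (a : R) (v : V) :
  a *: quotmod_pi S v = quotmod_pi S (a *: v).
Proof. exact/esym/quotmod_piZ. Qed.

Lemma quotmod_pi_eq0 (v : V) : quotmod_pi S v = 0 <-> v \in S.
Proof.
have <- : quotmod_pi S 0 = 0 by exact: raddf0.
by rewrite -[X in X \in _](subr0 v); exact: quotmod_piP.
Qed.

Lemma quotmod_annihilated (x : R) :
  (forall v : V, x *: v \in S) -> forall c : quotmod S, x *: c = 0.
Proof.
move=> xS c; rewrite -[c]quotmod_reprK quotmod_scaleE.
by apply/quotmod_pi_eq0; exact: xS.
Qed.

End QuotientModule.

(** * Null-homotopy of multiplication by an annihilator, and its consequences *)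

Section Homotopy.
Variables (R : comNzRingType) (M : lmodType R) (F : free_resolution M) (x : R).
Hypothesis xM : forall v : M, x *: v = 0.

Lemma bd_comp i : bd F i.+1 *m bd F i = 0.
Proof.
apply/row_matrixP => j; rewrite row_mul row0.
by apply/bd_exact; exists (delta_mx 0 j); rewrite rowE.
Qed.

Lemma lift_rows n p q (A : 'M[R]_(n, q)) (B : 'M[R]_(p, q)) :
  (forall i, exists v, row i A = v *m B) -> exists C, A = C *m B.
Proof.
move=> /boolp.choice[f fE]; exists (\matrix_i f i).
by apply/row_matrixP => i; rewrite row_mul rowK.
Qed.

Lemma bd_lift n i (A : 'M[R]_(n, rk F i.+1)) :
  A *m bd F i = 0 -> exists B, A = B *m bd F i.+1.
Proof.
by move=> A0; apply: lift_rows => j; apply/bd_exact; rewrite -row_mul A0 row0.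
Qed.

(** Since [x] kills M, each row of [x%:M] is sent to 0 by [aug], so it lifts through [bd F 0]. *)
Lemma homotopy0 : exists s, x%:M = s *m bd F 0.
Proof.
apply: lift_rows => i; apply/aug_exact.
by rewrite rowE mul_mx_scalar linearZ /= xM.
Qed.

Lemma homotopyS i : exists s s', x%:M = s' *m bd F i.+1 + bd F i *m s.
Proof.
elim: i => [|i [s0 [s e]]].
  have [s e] := homotopy0; exists s.
  have [|s' e'] := @bd_lift _ 0 (x%:M - bd F 0 *m s).
    by rewrite mulmxBl -mulmxA -e mul_mx_scalar mul_scalar_mx subrr.
  by exists s'; rewrite -e' subrK.
(* The homotopy [s] of the previous degree is reused. By [e], the product of this difference with
   [bd F i.+1] equals [bd F i.+1 *m bd F i *m s0], which is 0. *)
exists s; have [|s' e'] := @bd_lift _ i.+1 (x%:M - bd F i.+1 *m s).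
  rewrite mulmxBl -mulmxA -[s *m _](addrK (bd F i *m s0)) -e.
  by rewrite mulmxBr mulmxA bd_comp mul0mx subr0 mul_mx_scalar mul_scalar_mx subrr.
by exists s'; rewrite -e' subrK.
Qed.

(** The homotopy dualizes: on a cocycle z the term through [bd F i.+1] vanishes, so x z is the
    coboundary of [s *m z]. *)
Lemma ext_annihilated i (c : Ext F i.+1) : x *: c = 0.
Proof.
have [s [s' e]] := homotopyS i.
apply: quotmod_annihilated c => z; rewrite inE; exists (s *m val z).
rewrite linearZ /= -mul_scalar_mx e mulmxDl -!mulmxA.
have /eqP -> : bd F i.+1 *m val z == 0 := valP z.
by rewrite mulmx0 add0r.
Qed.

(** Over K the homotopy writes an invertible scalar matrix as a sum of products through two
    consecutive differentials, so their ranks add up to at least the rank of the free module. The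
    reverse inequality holds because consecutive differentials compose to 0. *)
Lemma base_change_exact (K : fieldType) (phi : {rmorphism R -> K}) :
  phi x != 0 ->
  \rank (map_mx phi (bd F 0)) = rk F 0 /\
  forall i, (\rank (map_mx phi (bd F i.+1)) + \rank (map_mx phi (bd F i)))%N
    = rk F i.+1.
Proof.
move=> x0.
have unit_x n : (phi x)%:M \in @unitmx K n.
  by rewrite unitmxE det_scalar unitrX // unitfE.
split=> [|i].
  have [s /(congr1 (map_mx phi))] := homotopy0.
  rewrite map_mxM map_scalar_mx => e; apply/eqP.
  rewrite eqn_leq rank_leq_col.
  by rewrite -[X in (X <= _)%N](mxrank_unit (unit_x _)) e mxrankM_maxr.
have [s [s' /(congr1 (map_mx phi))]] := homotopyS i.
rewrite map_mxD !map_mxM map_scalar_mx => e; apply/eqP.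
rewrite eqn_leq mulmx0_rank_max -?map_mxM ?bd_comp ?map_mx0 //=.
rewrite -[X in (X <= _)%N](mxrank_unit (unit_x _)) e (leq_trans (mxrank_add _ _)) //.
by rewrite leq_add ?mxrankM_maxr ?mxrankM_maxl.
Qed.

End Homotopy.

(** * Dimension of homology over a field *)

Section Dimension.
Variable k : fieldType.

Lemma vector_axiom_bij n (V : lmodType k) (f : 'rV[k]_n -> V) :
  linear f -> injective f -> (forall z, exists w, f w = z) -> Vector.axiom n V.
Proof.
move=> flin finj /boolp.choice[f' f'K]; exists f'.
  by move=> a u v; apply: finj; rewrite flin !f'K.
by exists f => // w; apply: finj; rewrite f'K.
Qed.

Lemma linear_inj_leq m n (f : {linear 'rV[k]_m -> 'rV[k]_n}) :
  injective f -> (m <= n)%N.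
Proof.
move=> finj; suff /eqP <- : row_free (lin1_mx f) by exact: rank_leq_col.
apply: inj_row_free => v; rewrite mul_rV_lin1 => fv.
by apply: finj; rewrite fv raddf0.
Qed.

Lemma vector_axiom_leq m n (V : lmodType k) :
  Vector.axiom m V -> Vector.axiom n V -> (m <= n)%N.
Proof.
move=> [f flin [f' fK f'K]] [g glin [g' gK g'K]].
have lin : linear (g \o f').
  by move=> a u v /=; rewrite -glin; congr g; apply: (can_inj fK); rewrite f'K flin !f'K.
pose H : {linear 'rV[k]_m -> 'rV[k]_n} :=
  HB.pack (g \o f') (GRing.isLinear.Build _ _ _ _ (g \o f') lin).
apply: (@linear_inj_leq _ _ H).
exact: inj_comp (can_inj gK) (can_inj f'K).
Qed.

(** Invariance of dimension makes the choice of [xget] irrelevant. *)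
Lemma dimensionE n (V : lmodType k) : Vector.axiom n V -> dimension V = n.
Proof.
move=> Vn; rewrite /dimension; case: xgetP => [p -> [Vp]|/(_ n)[]]; last by split.
by apply/eqP; rewrite eqn_leq !(vector_axiom_leq Vn Vp, vector_axiom_leq Vp Vn).
Qed.

(** A complement [C] of the image of [A] in the kernel of [B] maps isomorphically onto the homology;
    rank-nullity for [B] does the rest. *)
Lemma dimension_homology p q r (A : 'M[k]_(p, q)) (B : 'M[k]_(q, r)) :
  A *m B = 0 ->
  (dimension (homology (mulmxr A : {linear 'rV_p -> 'rV_q})
                       (mulmxr B : {linear 'rV_q -> 'rV_r}))
    + \rank A + \rank B)%N = q.
Proof.
move=> AB0; set H := homology _ _; pose C := (kermx B :\: A)%MS.
have CK (w : 'rV_(\rank C)) : ker_pred (mulmxr B) (w *m row_base C).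
  rewrite /ker_pred /=; apply/eqP/sub_kermxP; apply: submx_trans (submxMl _ _) _.
  by rewrite eq_row_base diffmxSl.
pose z w : kernel (mulmxr B) := Sub (w *m row_base C) (CK w).
pose f w : H := quotmod_pi _ (z w).
have -> : dimension H = \rank C.
  apply: dimensionE; apply: (@vector_axiom_bij _ _ f).
  - move=> a u v; rewrite /f quotmod_scaleE -quotmod_piD; congr quotmod_pi.
    by apply: val_inj; rewrite /= mulmxDl scalemxAl.
  (* The difference of the two cycles lies both in [C] and in the row space of [A], which meet in
     0. *)
  - move=> u v /quotmod_piP; rewrite inE /= => -[w wA].
    apply: (row_free_inj (row_base_free C)); apply/eqP; rewrite -subr_eq0 -submx0.
    rewrite -(capmx_diff (kermx B) A) sub_capmx -{2}wA submxMl andbT.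
    by rewrite -mulmxBl; apply: submx_trans (submxMl _ _) _; rewrite eq_row_base.
  - move=> c; rewrite -[c]quotmod_reprK; set y := repr _.
    have /eqP yB : val y *m B == 0 := valP y.
    (* A cycle splits into a part in [C], which gives the preimage [w], and a part in the row space
       of [A], which is a boundary. *)
    have : (val y <= C + kermx B :&: A)%MS.
      by rewrite addsmx_diff_cap_eq; apply/sub_kermxP.
    case/sub_addsmxP => -[a b] /= yE.
    have /submxP[w wE] : (a *m C <= row_base C)%MS by rewrite eq_row_base submxMl.
    exists w; apply/quotmod_piP; rewrite inE /=.
    have /submxP[u uE] : (b *m (kermx B :&: A)%MS <= A)%MS.
      by apply: submx_trans (submxMl _ _) _; exact: capmxSr.
    by exists (- u); rewrite /= mulNmx -uE -wE yE opprD addNKr.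
have := mxrank_cap_compl (kermx B) A.
have -> : \rank (kermx B :&: A)%MS = \rank A.
  apply/eqmx_rank/andP; split; rewrite ?capmxSr //.
  by rewrite sub_capmx submx_refl andbT; apply/sub_kermxP.
by rewrite mxrank_ker addnC => ->; rewrite subnK // rank_leq_row.
Qed.

End Dimension.

(** * Betti numbers in terms of the ranks of the differentials *)

Section Betti.
Variables (R : comNzRingType) (m : idealr R) (mmax : maximal_ideal m).
Variables (M : lmodType R) (F : free_resolution M).

Lemma betti0 : (betti mmax F 0 + \rank (bdk F mmax 0))%N = rk F 0.
Proof.
have := @dimension_homology _ _ _ _ (bdk F mmax 0)
  (0 : 'M[residue_field mmax]_(rk F 0, 0)) (mulmx0 _ _).
by rewrite mxrank0 addn0.
Qed.

Lemma bettiS i :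
  (betti mmax F i.+1 + \rank (bdk F mmax i.+1) + \rank (bdk F mmax i))%N
    = rk F i.+1.
Proof.
by apply: dimension_homology; rewrite -map_mxM bd_comp map_mx0.
Qed.

Lemma rank_residue_le p q (A : 'M[R]_(p, q)) :
  exists2 d, d \notin m &
    forall (K : fieldType) (phi : {rmorphism R -> K}), phi d != 0 ->
      (\rank (map_mx (residue mmax) A) <= \rank (map_mx phi A))%N.
Proof.
pose Ak := map_mx (residue mmax) A.
have lift a b (X : 'M[residue_field mmax]_(a, b)) :
    exists Y, X = map_mx (residue mmax) Y.
  have /boolp.choice[f fK] := @residue_surj _ _ mmax.
  by exists (map_mx f X); apply/matrixP => i j; rewrite !mxE fK.
(* [Ak] is [col_base Ak *m row_base Ak], a full-rank factorization: [P] lifts a left inverse of the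
   first factor and [Q] a right inverse of the second. *)
have [P PE] := lift _ _ (pinvmx (col_base Ak)).
have [Q QE] := lift _ _ (pinvmx (row_base Ak)).
have PAQ : map_mx (residue mmax) (P *m A *m Q) = 1%:M.
  have PA : pinvmx (col_base Ak) *m Ak = row_base Ak.
    rewrite -[X in _ *m X = _](mulmx_base Ak) mulmxA.
    by rewrite mulVpmx ?mul1mx ?col_base_full.
  by rewrite !map_mxM -PE -QE PA mulmxVp ?row_base_free.
exists (\det (P *m A *m Q)).
  by rewrite -(residue_eq0 mmax) -det_map_mx PAQ det1 oner_eq0.
move=> K phi; rewrite -det_map_mx => d0.
have := mxrank_unit (_ : map_mx phi (P *m A *m Q) \in unitmx).
rewrite unitmxE unitfE => /(_ d0) rkE; rewrite -/Ak -[X in (X <= _)%N]rkE.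
rewrite !map_mxM; apply: leq_trans (mxrankM_maxl _ _) _.
exact: mxrankM_maxr.
Qed.

(** Computing the rank of each free module over both fields writes the Betti number in degree i as a
    sum of the rank defects (rank over K minus rank over k) of [bd F i] and [bd F (i-1)], so the
    alternating sum telescopes. *)
Lemma poincare_le_rank (x : R) (K : fieldType) (phi : {rmorphism R -> K}) n :
  (forall v : M, x *: v = 0) -> phi x != 0 ->
  (poincare_le mmax F n).[-1] = (-1) ^+ n *
    ((\rank (map_mx phi (bd F n)))%:Z - (\rank (bdk F mmax n))%:Z).
Proof.
move=> xM x0; have [rk0 rkS] := base_change_exact F xM x0.
rewrite horner_poly; elim: n => [|n IH].
  by rewrite big_ord1 expr0 mulr1 mul1r rk0 -[X in X%:Z - _]betti0 PoszD addrK.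
rewrite big_ord_recr /= {}IH exprS mulN1r.
have -> : (betti mmax F n.+1)%:Z =
    ((\rank (map_mx phi (bd F n.+1)))%:Z - (\rank (bdk F mmax n.+1))%:Z)
    + ((\rank (map_mx phi (bd F n)))%:Z - (\rank (bdk F mmax n))%:Z).
  by rewrite addrACA -opprD -!PoszD rkS -[X in X%:Z - _](bettiS n) -addnA PoszD addrK.
rewrite mulrN mulNr (mulrC _ ((-1) ^+ n)) -mulrBr -mulrN; congr (_ * _).
by rewrite opprD addrCA subrr addr0.
Qed.

Lemma poincare_le_sign (x : R) n :
  (forall r, x * r = 0 -> r = 0) -> (forall v : M, x *: v = 0) ->
  0 <= (-1) ^+ n * (poincare_le mmax F n).[-1].
Proof.
move=> xreg xM; have [d dm le_rk] := rank_residue_le (bd F n).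
(* If a power of [x * d] were 0, regularity of [x] would make a power of [d] vanish, whereas [d] is
   nonzero in the residue field. *)
have [|K [phi]] := @exists_field_nonnilpotent R (x * d).
  have xjreg j u : x ^+ j * u = 0 -> u = 0.
    elim: j u => [|j IH] u; first by rewrite expr0 mul1r.
    by rewrite exprS -mulrA => /xreg /IH.
  move=> j; apply: contraNneq dm; rewrite exprMn -(residue_eq0 mmax) => /xjreg dj.
  have : residue mmax d ^+ j == 0 by rewrite -rmorphXn dj rmorph0.
  by rewrite expf_eq0 => /andP[].
rewrite rmorphM mulf_eq0 negb_or => /andP[x0 d0].
rewrite (poincare_le_rank _ xM x0) mulrA -expr2 sqrr_sign mul1r subr_ge0.
by rewrite lez_nat le_rk.
Qed.

End Betti.

(** * From positive grade to the inequalities *)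

Lemma grade_gt0_regular (R : comNzRingType) (J : idealr R) g :
  is_grade J g -> (0 < g)%N ->
  exists2 x, x \in J & forall r, x * r = 0 -> r = 0.
Proof.
move=> [[[|x s] [sJ [_ sreg] <-]] _] // _; exists x.
  by apply: sJ; rewrite inE eqxx.
(* At index 0 the preceding elements form the empty sequence, whose span is 0, so the first term of
   a regular sequence is a nonzerodivisor. *)
move=> r xr; have [] := sreg 0%N isT r; rewrite /= ?xr.
  by exists (fun=> 0); rewrite big_ord0.
by move=> c ->; rewrite big_ord0.
Qed.

Theorem corollary2p2 (R : comNzRingType) (m : idealr R)
    (hCM : CM_local_ring m)
    (J : idealr R) (g : nat) (hg : is_grade J g) (g1 : (1 <= g)%N)
    (F : free_resolution (quot_by_ideal J)) (G : free_resolution (Ext F g)) :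
  (odd g -> (poincare_le (CM_local_maximal hCM) G g).[-1] <= 0) /\
  (g = 1%N -> (betti (CM_local_maximal hCM) G 0 <= betti (CM_local_maximal hCM) G 1)%N) /\
  (~~ odd g -> 0 <= (poincare_le (CM_local_maximal hCM) G g).[-1]).
Proof.
have [x xJ xreg] := grade_gt0_regular hg g1.
have xJ0 (v : quot_by_ideal J) : x *: v = 0.
  apply: quotmod_annihilated v => a; rewrite inE.
  by have := idealMr a xJ; rewrite mulrC.
have xE : forall c : Ext F g, x *: c = 0.
  (* [g1] puts [Ext F g] in positive degree, where the homotopy applies. *)
  by case: g g1 {hg G} => // g _; exact: ext_annihilated.
have sgn := poincare_le_sign (CM_local_maximal hCM) G g xreg xE.
have odd_le0 : odd g -> (poincare_le (CM_local_maximal hCM) G g).[-1] <= 0.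
  by move=> og; move: sgn; rewrite -signr_odd og expr1 mulN1r oppr_ge0.
split=> //; split=> [g1E|/negPf og].
  have := odd_le0; rewrite [in odd _]g1E => /(_ isT).
  (* The type of [G] depends on [g], so only the truncation degree is replaced by 1; the value at -1
     is then the Betti number in degree 0 minus that in degree 1. *)
  have -> : poincare_le (CM_local_maximal hCM) G g
      = poincare_le (CM_local_maximal hCM) G 1 by congr (poincare_le _ _ _).
  rewrite horner_poly !big_ord_recl big_ord0 /=.
  by rewrite expr0 mulr1 addr0 expr1 mulrN1 subr_le0 lez_nat; exact.
by move: sgn; rewrite -signr_odd og expr0 mul1r.
Qed.
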